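(* Let $(y_n)$ be a sequence in a real Banach space $X$ and let $E \subseteq X^*$ be an isomorphically precisely norming set for $X$. If $c_0$ does not embed isomorphically in the closed linear span $[y_n]$ of $(y_n)$ and \[ \sum_n |x^*(y_n)| < \infty \quad \text{for all } x^*\in E, \] then $\sum_n y_n$ converges unconditionally in norm.
   Context: A set $E \subseteq X^*$ is called isomorphically precisely norming for a Banach space $(X,\|\cdot\|)$ if there exists $C \ge 1$ such that (a) $E \subseteq C\cdot Ba(X^* )$ (where $Ba(X^* )$ is the closed unit ball of $X^*$); (b) $\frac{1}{C}\|x\| \le \sup_{e\in E}|e(x)|$ for all $x \in X$; and (c) for every $x\in X$ there is $e_0 \in E$ with $|e_0(x)| = \sup_{e\in E}|e(x)|$. *)

(* Defs.v *)
From HB Require Import structures.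
From mathcomp Require Import all_boot all_order all_algebra.
From mathcomp Require Import all_classical all_reals all_analysis.
Set Implicit Arguments. Unset Strict Implicit. Unset Printing Implicit Defensive.
Import Order.TTheory GRing.Theory Num.Theory.
Import numFieldNormedType.Exports.
Local Open Scope classical_set_scope.
Local Open Scope ring_scope.

Section Defs.
Variables (R : realType) (X : normedModType R).

Definition is_dual_elt (f : X -> R) : Prop :=
  (forall (a : R) (x z : X), f (a *: x + z) = a * f x + f z) /\ continuous f.

Definition Esup (E : set (X -> R)) (x : X) : R := sup [set `|e x| | e in E].

Definition iso_precisely_norming (E : set (X -> R)) : Prop :=
  (forall e, E e -> is_dual_elt e) /\
  exists C : R, 1 <= C /\
    (forall e, E e -> forall x : X, `|e x| <= C * `|x|) /\
    (forall x : X, C^-1 * `|x| <= Esup E x) /\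
    (forall x : X, exists2 e0, E e0 & `|e0 x| = Esup E x).

Definition lin_span (y : nat -> X) : set X :=
  [set x | exists (n : nat) (c : nat -> R), x = \sum_(i < n) c i *: y i].
Definition closed_lin_span (y : nat -> X) : set X := closure (lin_span y).

Definition c0seq (u : nat -> R) : Prop := u @ \oo --> (0 : R).
Definition c0norm (u : nat -> R) : R := sup (range (fun n => `|u n|)).

Definition c0_embeds_in (S : set X) : Prop :=
  exists T : (nat -> R) -> X,
    (forall u, c0seq u -> S (T u)) /\
    (forall (a : R) u v, c0seq u -> c0seq v ->
        T (fun n => a * u n + v n) = a *: T u + T v) /\
    exists a b : R, 0 < a /\ 0 < b /\
      forall u, c0seq u -> a * c0norm u <= `|T u| /\ `|T u| <= b * c0norm u.

Definition uncond_convergent (y : nat -> X) : Prop :=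
  forall s : nat -> nat, bijective s -> cvgn (series (fun n => y (s n))).

End Defs.

(* Main.v *)
Require Import Defs.
From HB Require Import structures.
From mathcomp Require Import all_boot all_order all_algebra.
From mathcomp Require Import all_classical all_reals all_analysis.
From mathcomp Require Import ring lra zify.
Import Order.TTheory GRing.Theory Num.Theory.
Import numFieldNormedType.Exports.
Local Open Scope classical_set_scope.
Local Open Scope ring_scope.

(** Suppose that the sums [\sum_n |e (y n)|] are not bounded over [e \in E].
    Then no set [E_J] of functionals with sum at most [J] is norming on the span
    of [y], so there are vectors of prescribed norm that are arbitrarily small
    on [E_J] (as in Fonf's theorem on increasing countable covers of boundaries).
    Choose [x_0, x_1, ...] in the span greedily, as large as possible, with all
    signed sums bounded for a renorming giving more weight to functionals with a
    small sum. As [c_0] does not embed, [\sum x_n] converges unconditionally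
    (Bessaga-Pelczynski), so by attainment its weighted supremum comes only from
    some [E_J]; a vector of fixed size small on [E_J] could then have been chosen
    at every late step, which contradicts [x_n --> 0]. Hence the sums are bounded
    over [E], and Bessaga-Pelczynski applied to [y] itself concludes. *)

Set Implicit Arguments.
Unset Strict Implicit.
Unset Printing Implicit Defensive.

(** * Variations along functionals, linear spans, a Cauchy criterion *)

Section Variation.
Context {R : realType} {X : normedModType R}.
Implicit Types (e : X -> R) (x : nat -> X) (c : nat -> R) (u v : X).

Lemma dual_eltD e u v : is_dual_elt e -> e (u + v) = e u + e v.
Proof. by move=> [le _]; rewrite -[u in LHS]scale1r le mul1r. Qed.

Lemma dual_elt0 e : is_dual_elt e -> e 0 = 0.
Proof. by move=> de; have := dual_eltD 0 0 de; rewrite addr0; lra. Qed.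

Lemma dual_eltZ e (a : R) u : is_dual_elt e -> e (a *: u) = a * e u.
Proof.
by move=> de; have := de.1 a u 0; rewrite addr0 (dual_elt0 de) addr0.
Qed.

Lemma dual_eltB e u v : is_dual_elt e -> e (u - v) = e u - e v.
Proof.
by move=> de; rewrite dual_eltD // -scaleN1r dual_eltZ // mulN1r.
Qed.

Lemma dual_elt_sum e x c a b : is_dual_elt e ->
  e (\sum_(a <= i < b) c i *: x i) = \sum_(a <= i < b) c i * e (x i).
Proof.
move=> de; rewrite (big_morph e (fun u v => dual_eltD u v de) (dual_elt0 de)).
by apply: eq_bigr => i _; rewrite dual_eltZ.
Qed.

Definition var e x a b : R := \sum_(a <= i < b) `|e (x i)|.

Lemma var_ge0 e x a b : 0 <= var e x a b.
Proof. by apply: sumr_ge0. Qed.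

Lemma var_cat e x a b d : (a <= b <= d)%N ->
  var e x a d = var e x a b + var e x b d.
Proof. by move=> /andP[ab bd]; rewrite /var (big_cat_nat ab bd). Qed.

Lemma var_recr e x n : var e x 0 n.+1 = var e x 0 n + `|e (x n)|.
Proof. by rewrite /var big_nat_recr. Qed.

Lemma var1 e x n : var e x n n.+1 = `|e (x n)|.
Proof. by rewrite /var big_nat1. Qed.

Lemma le_var e x a a' b b' : (a' <= a)%N -> (b <= b')%N ->
  var e x a b <= var e x a' b'.
Proof.
move=> aa bb; have [ba|ab] := leqP b a.
  by rewrite {1}/var big_geq // var_ge0.
rewrite (@var_cat e x a' a b'); last by apply/andP; split => //; lia.
rewrite (@var_cat e x a b b'); last by apply/andP; split => //; lia.
by have := var_ge0 e x a' a; have := var_ge0 e x b b'; lra.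
Qed.

Lemma ler_dual_sum e x c a b (d : R) : is_dual_elt e ->
  (forall i, (a <= i < b)%N -> `|c i| <= d) ->
  `|e (\sum_(a <= i < b) c i *: x i)| <= d * var e x a b.
Proof.
move=> de cd; rewrite dual_elt_sum // (le_trans (ler_norm_sum _ _ _)) //.
rewrite /var mulr_sumr big_nat [leRHS]big_nat.
by apply: ler_sum => i iab; rewrite normrM ler_wpM2r // cd.
Qed.

(** Signs turn a variation into the value of [e] at one vector; the blocks and small vectors below
    are built this way. *)
Lemma var_sg e x a b : is_dual_elt e ->
  e (\sum_(a <= i < b) Num.sg (e (x i)) *: x i) = var e x a b.
Proof.
by move=> de; rewrite dual_elt_sum //; apply: eq_bigr => i _; rewrite normrEsg.
Qed.

Lemma normr_sg_le1 (a : R) : `|Num.sg a| <= 1.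
Proof. by rewrite normr_sg; case: (a == 0) => /=; lra. Qed.

Lemma lin_span0 x : lin_span x 0.
Proof. by exists 0%N, (fun=> 0); rewrite big_ord0. Qed.

Lemma lin_spanD x a u v : lin_span x u -> lin_span x v -> lin_span x (a *: u + v).
Proof.
have widen n m (c : nat -> R) : (n <= m)%N ->
    \sum_(i < n) c i *: x i =
    \sum_(i < m) (if (i < n)%N then c i else 0) *: x i.
  move=> nm; rewrite (big_ord_widen _ (fun i => c i *: x i) nm) big_mkcond.
  by apply: eq_bigr => i _; case: ifP => // _; rewrite scale0r.
move=> [n [c ->]] [m [d ->]].
rewrite (widen n (n + m)%N) ?leq_addr// (widen m (n + m)%N) ?leq_addl//.
rewrite scaler_sumr -big_split /=.
eexists (n + m)%N, (fun i => a * (if (i < n)%N then c i else 0) +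
  (if (i < m)%N then d i else 0)).
by apply: eq_bigr => i _; rewrite scalerA scalerDl.
Qed.

Lemma lin_span_id x n : lin_span x (x n).
Proof.
exists n.+1, (fun i => (i == n)%:R).
rewrite big_ord_recr /= eqxx scale1r big1 ?add0r// => i _.
by rewrite (ltn_eqF (ltn_ord i)) scale0r.
Qed.

Lemma lin_span_sum (y x : nat -> X) c a b : (forall i, lin_span y (x i)) ->
  lin_span y (\sum_(a <= i < b) c i *: x i).
Proof.
move=> yx; elim/big_ind: _ => [|u v yu yv|i _]; first exact: lin_span0.
  by rewrite -(scale1r u); exact: lin_spanD.
by rewrite -(addr0 (_ *: _)); apply: lin_spanD => //; exact: lin_span0.
Qed.

End Variation.

Lemma cvg_series_tail (R : realType) (X : completeNormedModType R)
    (x : nat -> X) :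
  (forall d, 0 < d -> exists k, forall m n, (k <= m)%N ->
     `|\sum_(m <= i < n) x i| < d) -> cvgn (series x).
Proof.
move=> xd; apply/cauchy_cvgP/cauchy_seriesP => d /xd[k kd].
exists ([set n | (k <= n)%N], setT) => /=; first by split; [exists k|exists 0%N].
by move=> [m n] /= [km _]; exact: kd.
Qed.

(** * Copies of [c_0], small tails, attained suprema *)

Section Norming.
Context {R : realType} {X : completeNormedModType R}.
Implicit Types (e : X -> R) (x : nat -> X) (c : nat -> R).
Variables (E : set (X -> R)) (C : R).
Hypothesis dualE : forall e, E e -> is_dual_elt e.
Hypothesis E_le : forall e u, E e -> `|e u| <= C * `|u|.
Hypothesis E_attain : forall u, exists e, [/\ E e, `|u| <= C * `|e u| &
  forall e', E e' -> `|e' u| <= `|e u|].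
Hypothesis C_gt0 : 0 < C.

Let E0 : E !=set0. Proof. by have [e []] := E_attain 0; exists e. Qed.

(** The functional of [E] attaining its supremum at the sum recovers the norm up to [C], so
    variation bounds over [E] become norm bounds. *)
Lemma norm_sum_le x c a b (d A : R) :
  (forall i, (a <= i < b)%N -> `|c i| <= d) -> 0 <= d ->
  (forall e, E e -> var e x a b <= A) ->
  `|\sum_(a <= i < b) c i *: x i| <= C * (d * A).
Proof.
move=> cd d0 xA; have [e [Ee le _]] := E_attain (\sum_(a <= i < b) c i *: x i).
apply: (le_trans le); rewrite ler_pM2l //.
apply: (le_trans (ler_dual_sum x (dualE Ee) cd)).
by rewrite ler_wpM2l // xA.
Qed.

Lemma c0norm_ge (u : nat -> R) n : c0seq u -> `|u n| <= c0norm u.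
Proof.
move=> cu; apply: ub_le_sup; last by exists n.
have /cvg_seq_bounded[M [_ /(_ (M + 1))]] : cvgn u by apply/cvg_ex; exists 0.
rewrite ltrDl ltr01 => /(_ isT) uM.
by exists (M + 1) => _ [m _ <-]; exact: uM.
Qed.

(* If one term of [\sum u_i z_i] is singled out, the remaining ones can only
   cancel [A - b < b] of its contribution. *)
Lemma c0_embeds_of_blocks (y z : nat -> X) (A b : R) :
  (forall j, lin_span y (z j)) ->
  (forall e n, E e -> var e z 0 n <= A) ->
  (forall j, exists2 e, E e & b <= `|e (z j)|) -> A < 2 * b ->
  c0_embeds_in (closed_lin_span y).
Proof.
move=> yz zA bz Ab.
have A0 : 0 <= A.
  by have [e Ee] := E0; apply: le_trans (zA e 0%N Ee); exact: var_ge0.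
have zA' e a n : E e -> var e z a n <= A.
  by move=> Ee; apply: le_trans (zA e n Ee); exact: le_var.
have cvgT u : c0seq u -> cvgn (series (fun n => u n *: z n)).
  move=> u0; apply: cvg_series_tail => d d0.
  (* [A + 1] instead of [A], since [A] may vanish. *)
  pose d' := d / (C * (A + 1)).
  have CA : 0 < C * (A + 1) by rewrite mulr_gt0 //; lra.
  have d'0 : 0 < d' by rewrite divr_gt0.
  have /cvgrPdist_lt/(_ _ d'0)[k _ ku] := u0.
  exists k => m n km.
  apply: (@le_lt_trans _ _ (C * (d' * A))).
    apply: norm_sum_le; [|exact: ltW|by move=> e; exact: zA'].
    move=> i /andP[mi _]; have := ku i (leq_trans km mi).
    by rewrite sub0r normrN => /ltW.
  rewrite mulrCA mulrA -mulrA [ltRHS](_ : d = d' * (C * (A + 1))); last first.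
    by rewrite /d' divfK // gt_eqF.
  by rewrite ltr_pM2l // ltr_pM2l //; lra.
have normT u n : c0seq u ->
    `|series (fun n => u n *: z n) n| <= C * A * c0norm u.
  move=> u0; rewrite -mulrA [A * _]mulrC; apply: norm_sum_le => //.
  - by move=> i _; exact: c0norm_ge.
  - by apply: le_trans (c0norm_ge 0 u0).
  - by move=> e; exact: zA.
exists (fun u => limn (series (fun n => u n *: z n))); split; last split.
- move=> u u0; apply: (closed_cvg (closed_lin_span y)) (cvgT u u0).
    exact: closed_closure.
  apply: nearW => n; apply: subset_closure; exact: lin_span_sum.
- move=> a u v u0 v0; apply/cvg_lim => //.
  rewrite (_ : series _ = (fun n => a *: series (fun n => u n *: z n) n +
    series (fun n => v n *: z n) n)); last first.
    apply/funext => n; rewrite /series /= scaler_sumr -big_split /=.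
    by apply: eq_bigr => i _; rewrite scalerDl scalerA.
  by apply: cvgD; [apply: cvgZr|]; exact: cvgT.
(* The lower constant comes from the supremum over [n] in [low], which gives
   [b * U <= C * |T u| + (A - b) * U] with [U = c0norm u]. *)
- exists ((2 * b - A) / C), (C * A + 1); split; first by rewrite divr_gt0 //; lra.
  split; first by have := mulr_ge0 (ltW C_gt0) A0; lra.
  move=> u u0; split; last first.
    apply: (@le_trans _ _ (C * A * c0norm u)); last first.
      by rewrite ler_wpM2r ?lerDl// (le_trans _ (c0norm_ge 0 u0)).
    apply: (closed_cvg [set t | t <= C * A * c0norm u]) (cvg_norm (cvgT u u0)).
      exact: closed_le.
    by apply: nearW => n; exact: normT.
  have low n : b * `|u n| <= C * `|limn (series (fun n => u n *: z n))| +
      (A - b) * c0norm u.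
    have [e Ee be] := bz n.
    rewrite -lerBlDr [leRHS]mulrC -ler_pdivrMr //.
    set l := _ / C.
    apply: (closed_cvg [set t | l <= t]) (cvg_norm (cvgT u u0)).
      exact: closed_ge.
    exists n.+1 => // N /= nN; rewrite /l ler_pdivrMr // [leRHS]mulrC.
    apply: le_trans (E_le _ Ee).
    rewrite /series /= dual_elt_sum; last exact: dualE.
    rewrite (@big_cat_nat _ _ _ n.+1) //= big_nat_recr //=.
    set s1 := \sum_(_ <= i < n) _; set s2 := \sum_(_ <= i < N) _.
    have s_le (a d : nat) :
        `|\sum_(a <= i < d) u i * e (z i)| <= c0norm u * var e z a d.
      rewrite -dual_elt_sum; last exact: dualE.
      by apply: ler_dual_sum => [|i _]; [exact: dualE|exact: c0norm_ge].
    have := s_le 0%N n; have := s_le n.+1 N; rewrite -/s1 -/s2 => h2 h1.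
    have := zA e N Ee; rewrite (@var_cat _ _ e z 0 n.+1 N) // var_recr => h.
    have un := c0norm_ge n u0.
    have h3 : `|u n * e (z n)| <= `|s1 + u n * e (z n) + s2| + `|s1| + `|s2|.
      rewrite -(normrN s1) -(normrN s2) -[X in `|X| <= _](_ :
        s1 + u n * e (z n) + s2 + - s1 + - s2 = _); last by ring.
      apply: le_trans (ler_normD _ _) _; rewrite lerD2r; exact: ler_normD.
    rewrite normrM in h3.
    have := var_ge0 e z 0 n; have := var_ge0 e z n.+1 N.
    move: (var e z 0 n) (var e z n.+1 N) h h1 h2 => p q h h1 h2 q0 p0.
    have u0' := normr_ge0 (u n).
    (* Having [g >= b] only helps: the singled-out term grows while the room [A - g] left to the
       others shrinks. *)
    set g := `|e (z n)| in h h3 be *; set U := c0norm u in h1 h2 un *.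
    have : U * (p + q) <= U * (A - g) by rewrite ler_wpM2l //; lra.
    have : 0 <= (U - `|u n|) * (g - b) by rewrite mulr_ge0 //; lra.
    have : 0 <= U * (g - b) by rewrite mulr_ge0 //; lra.
    rewrite [b * _]mulrC; nra.
  rewrite mulrAC ler_pdivrMr // [leRHS]mulrC.
  have : c0norm u <= (C * `|limn (series (fun n => u n *: z n))| +
      (A - b) * c0norm u) / b.
    apply: ge_sup; first by exists `|u 0%N|, 0%N.
    move=> _ [n _ <-]; rewrite ler_pdivlMr; last lra.
    by rewrite mulrC.
  by rewrite ler_pdivlMr; lra.
Qed.


(* James' distortion argument: past an index [K] where the suprema of the tail
   variations are almost equal to their infimum [m], normalized blocks have
   variations at most [5/4 m] and norm at least [3/4 m]. *)
Lemma uniform_tail (y x : nat -> X) (A : R) :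
  (forall j, lin_span y (x j)) ->
  (forall e n, E e -> var e x 0 n <= A) ->
  ~ c0_embeds_in (closed_lin_span y) ->
  forall d, 0 < d -> exists k, forall e n, E e -> var e x k n <= d.
Proof.
move=> yx xA nc0 d d0; apply: contrapT => noK; apply: nc0.
pose V k := [set r | exists e n, E e /\ r = var e x k n].
have V0 k : V k !=set0 by have [e Ee] := E0; exists (var e x k 0), e, 0%N.
have Vub k : has_ubound (V k).
  exists A => _ [e [n [Ee ->]]]; apply: le_trans (xA e n Ee); exact: le_var.
pose S := [set sup (V k) | k in setT].
have dS : lbound S d.
  move=> _ [k _ <-]; rewrite leNgt; apply/negP => Vd; apply: noK; exists k.
  move=> e n Ee; apply/ltW/(le_lt_trans _ Vd)/ub_le_sup; first exact: Vub.
  by exists e, n.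
have hS : has_inf S by split; [exists (sup (V 0%N)), 0%N|exists d].
pose m := inf S.
have dm : d <= m by apply: lb_le_inf; first exact: hS.1.
have [_ [K _ <-]] : exists2 r, S r & r < m + m / 4.
  by apply: inf_adherent => //; lra.
move=> VK.
have K_le e n : E e -> var e x K n <= 5 / 4 * m.
  move=> Ee; apply: (@le_trans _ _ (sup (V K))); last by lra.
  by apply: ub_le_sup; [exact: Vub|exists e, n].
have blk k : exists en : (X -> R) * nat,
    E en.1 /\ 3 / 4 * m < var en.1 x k en.2.
  have : 3 / 4 * m < sup (V k).
    apply: (@lt_le_trans _ _ m); first by lra.
    by apply: (ge_inf hS.2); exists k.
  by move=> /(sup_gt (V0 k))[_ [e [n [Ee ->]]] h]; exists (e, n).
have [f fP] := choice blk.
pose k j := iter j (fun i => (f i).2) K.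
have k_lt j : (k j < k j.+1)%N.
  rewrite ltnNge; apply/negP => kk; have := (fP (k j)).2.
  by rewrite /var big_geq //; lra.
pose e j := (f (k j)).1.
pose z j := \sum_(k j <= i < k j.+1) Num.sg (e j (x i)) *: x i.
have Kk j : (K <= k j)%N.
  by elim: j => //= j; move/leq_trans; apply; apply: ltnW; exact: k_lt.
(* The two constants fit because [5 / 4 < 2 * (3 / 4)]. *)
apply: (@c0_embeds_of_blocks y z (5 / 4 * m) (3 / 4 * m)).
- by move=> j; exact: lin_span_sum.
- move=> e' n Ee'; apply: le_trans (K_le e' (k n) Ee').
  elim: n => [|n IH]; first by rewrite /var big_geq // big_geq.
  rewrite var_recr (@var_cat _ _ e' x K (k n) (k n.+1)); last first.
    by rewrite Kk ltnW // k_lt.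
  apply: lerD => //; rewrite -[leRHS]mul1r; apply: ler_dual_sum.
    exact: dualE.
  by move=> i _; exact: normr_sg_le1.
- move=> j; exists (e j); first exact: (fP (k j)).1.
  rewrite /z var_sg; last exact: dualE (fP (k j)).1.
  by rewrite ger0_norm ?var_ge0 //; apply: ltW; exact: (fP (k j)).2.
- by lra.
Qed.

(* Signs are chosen one by one so as to keep the supremum over [E] unchanged;
   the functional attaining the norm of the resulting sum attains the supremum
   of the variations. *)
Lemma sup_variation_attained x (A : R) :
  (forall e n, E e -> var e x 0 n <= A) ->
  (forall d, 0 < d -> exists k, forall e n, E e -> var e x k n <= d) ->
  exists2 e0, E e0 & exists M, (forall e n, E e -> var e x 0 n <= M) /\
    forall d, 0 < d -> exists m, M - d < var e0 x 0 m.
Proof.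
move=> xA tail.
pose V := [set r | exists e n, E e /\ r = var e x 0 n].
have V0 : V !=set0 by have [e Ee] := E0; exists (var e x 0 0), e, 0%N.
have Vub : has_ubound V by exists A => _ [e [n [Ee ->]]]; exact: xA.
pose M := sup V.
(* Invariant of the sign choice: once [s] is fixed from the first [n] terms, nothing of the supremum
   [M] is lost. *)
pose P n (s : X) := forall d, 0 < d -> exists e m,
  [/\ E e, (n <= m)%N & M - d < `|e s| + var e x n m].
have step (p : nat * X) : exists c : R, `|c| <= 1 /\
    (P p.1 p.2 -> P p.1.+1 (p.2 + c *: x p.1)).
  case: p => n s /=.
  have [Ps|nP] := pselect (P n s); last by exists 0; rewrite normr0.
  have [Pp|nPp] := pselect (P n.+1 (s + 1 *: x n)).
    by exists 1; rewrite normr1.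
  have [Pm|nPm] := pselect (P n.+1 (s + (-1) *: x n)).
    by exists (-1); rewrite normrN1.
  (* If both signs failed, with defects [d1] and [d2], a functional within the smaller defect would
     refute one failure, as [|e s + e (x n)|] or [|e s - e (x n)|] equals [|e s| + |e (x n)|]. *)
  exfalso; move: nPp nPm => /existsNP[d1 /not_implyP[d10 N1]].
  move=> /existsNP[d2 /not_implyP[d20 N2]].
  have [e [m [Ee nm]]] := Ps (Num.min d1 d2) ltac:(by rewrite lt_min d10).
  have le1 : Num.min d1 d2 <= d1 by rewrite ge_min lexx.
  have le2 : Num.min d1 d2 <= d2 by rewrite ge_min lexx orbT.
  move=> h.
  (* The end [m.+1] makes room for index [n] when [m = n]. *)
  have {}h : M - Num.min d1 d2 < `|e s| + `|e (x n)| + var e x n.+1 m.+1.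
    apply: (lt_le_trans h); rewrite -addrA lerD2l -(var1 e x n) -var_cat.
      by rewrite le_var.
    by rewrite leqnSn ltnS nm.
  have F (c : R) : e (s + c *: x n) = e s + c * e (x n).
    by rewrite (dual_eltD _ _ (dualE Ee)) (dual_eltZ _ _ (dualE Ee)).
  have h1 : `|e s + e (x n)| + var e x n.+1 m.+1 <= M - d1.
    rewrite leNgt; apply/negP => h1; apply: N1; exists e, m.+1; split => //.
    by rewrite F mul1r.
  have h2 : `|e s - e (x n)| + var e x n.+1 m.+1 <= M - d2.
    rewrite leNgt; apply/negP => h2; apply: N2; exists e, m.+1; split => //.
    by rewrite F mulN1r.
  have := ler_norm (e s + e (x n)); have := ler_norm (- (e s + e (x n))).
  have := ler_norm (e s - e (x n)); have := ler_norm (- (e s - e (x n))).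
  rewrite !normrN; move: h h1 h2.
  by case: (ger0P (e s)) => _; case: (ger0P (e (x n))) => _; lra.
have [f fP] := choice step.
pose s := fix s n := if n is n'.+1 then s n' + f (n', s n') *: x n' else 0.
pose c n := f (n, s n).
have sE n : s n = series (fun n => c n *: x n) n.
  elim: n => [|n IH]; first by rewrite /series /= big_geq.
  by rewrite [LHS]/= {1}IH /series /= big_nat_recr.
have c1 i : `|c i| <= 1 by have [] := fP (i, s i).
have Ps n : P n (s n).
  elim: n => [|n IH]; last by have [_ /(_ IH)] := fP (n, s n).
  move=> d d0; have [_ [e [n [Ee ->]]] h] := sup_adherent d0 (conj V0 Vub).
  exists e, n; split => //; rewrite /= dual_elt0 ?normr0 ?add0r//.
  exact: dualE.
have cvgs : cvgn s.
  rewrite (_ : s = series (fun n => c n *: x n)); last by apply/funext.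
  apply: cvg_series_tail => d d0.
  have d0' : 0 < d / C / 2 by rewrite !divr_gt0.
  have [k kd] := tail _ d0'; exists k => m n km.
  apply: (@le_lt_trans _ _ (C * (1 * (d / C / 2)))).
    apply: norm_sum_le => // e Ee; apply: le_trans (kd e n Ee); exact: le_var.
  by rewrite mul1r -mulrA mulrCA mulVKf ?gt_eqF//; lra.
pose l := limn s.
have [e0 [Ee0 _ e0l]] := E_attain l.
exists e0 => //; exists M; split.
  by move=> e n Ee; apply: ub_le_sup => //; exists e, n.
(* Four errors of size [d / 4] add up: the defect in [P], the tail of [e], and the passage between
   [l] and [s n] for both [e] and [e0]. *)
move=> d d0; pose d' := d / 4; have d'0 : 0 < d' by rewrite /d'; lra.
have [k kd] := tail _ d'0.
have dC : 0 < d' / C by rewrite divr_gt0.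
have /cvgrPdist_lt/(_ _ dC)[k' _ k'd] := cvgs.
pose n := maxn k k'; exists n.
have nl e : E e -> `|e l - e (s n)| <= d'.
  move=> Ee; rewrite -dual_eltB; last exact: dualE.
  apply: le_trans (E_le _ Ee) _; rewrite mulrC -ler_pdivlMr //.
  by apply/ltW/k'd; exact: leq_maxr.
have [e [m [Ee nm h]]] := Ps n _ d'0.
have h1 : var e x n m <= d'.
  by apply: le_trans (kd e m Ee); apply: le_var; rewrite ?leq_maxl.
have h2 := nl _ Ee; have h3 := nl _ Ee0; have h4 := e0l _ Ee.
have h5 : `|e0 (s n)| <= var e0 x 0 n.
  by rewrite sE -[leRHS]mul1r; apply: ler_dual_sum; first exact: dualE.
have := ler_normB (e l) (e l - e (s n)); rewrite subKr.
have := ler_normD (e0 l - e0 (s n)) (e0 (s n)); rewrite subrK.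
by rewrite /d' in h h1 h2 h3; lra.
Qed.

(** * Greedy construction and uniform boundedness *)

(** The supremum over admissible vectors need not be attained, hence the factor 2. The budget [B]
    never decreases, so [0] remains admissible at every step. *)
Lemma greedy_sequence (y : nat -> X) (w : (X -> R) -> R) (B : nat -> R) :
  (forall e, E e -> 1 <= w e) -> (forall n, 0 <= B n <= B n.+1) ->
  exists x, [/\ forall n, lin_span y (x n),
    forall e n, E e -> w e * var e x 0 n.+1 <= B n &
    forall n z, lin_span y z ->
      (forall e, E e -> w e * (var e x 0 n + `|e z|) <= B n) ->
      forall e, E e -> exists2 e', E e' & `|e z| <= 2 * `|e' (x n)|].
Proof.
move=> w1 BP.
pose adm (p : nat * ((X -> R) -> R)) z := lin_span y z /\
  forall e, E e -> w e * (p.2 e + `|e z|) <= B p.1.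
(* The guards let a choice be made for every [p], with [0] as default. *)
have best p : exists z, (forall e, 0 <= p.2 e) -> adm p 0 -> adm p z /\
    forall z' e, adm p z' -> E e -> exists2 e', E e' & `|e z'| <= 2 * `|e' z|.
  have [p0|] := pselect (forall e, 0 <= p.2 e); last by exists 0.
  have [a0|] := pselect (adm p 0); last by exists 0.
  pose V := [set r | exists z e, [/\ adm p z, E e & r = `|e z|]].
  have V0 : V !=set0 by have [e Ee] := E0; exists `|e 0|, 0, e.
  have Vub : has_ubound V.
    exists (B p.1) => _ [z [e [az Ee ->]]]; apply: le_trans (az.2 e Ee).
    have := w1 e Ee; have := p0 e; have := normr_ge0 (e z); nra.
  have Vsup z e : adm p z -> E e -> `|e z| <= sup V.
    by move=> az Ee; apply: ub_le_sup => //; exists z, e.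
  have [V_gt0|V_le0] := ltP 0 (sup V).
    have h : sup V / 2 < sup V by lra.
    have [_ [z [e [az Ee ->]]] ez] := sup_gt V0 h.
    exists z => _ _; split => // z' e' az' Ee'; exists e => //.
    by apply: (le_trans (Vsup _ _ az' Ee')); lra.
  exists 0 => _ _; split => // z' e' az' Ee'; exists e' => //.
  apply: (le_trans (Vsup _ _ az' Ee')); apply: (le_trans V_le0).
  by rewrite mulr_ge0.
have [f fP] := choice best.
pose t := fix t n := if n is n'.+1
  then fun e : X -> R => t n' e + `|e (f (n', t n'))| else fun=> 0.
pose x n := f (n, t n).
have tE n e : t n e = var e x 0 n.
  elim: n => [|n IH]; first by rewrite /var big_geq.
  by rewrite var_recr -IH.
have t_ge0 n e : 0 <= (n, t n).2 e by rewrite /= tE var_ge0.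
have a0 n : adm (n, t n) 0.
  elim: n => [|n IH]; split; try exact: lin_span0.
    move=> e Ee /=; rewrite dual_elt0 ?normr0; last exact: dualE.
    by rewrite addr0 mulr0; case/andP: (BP 0%N).
  move=> e Ee /=; rewrite dual_elt0 ?normr0 ?addr0; last exact: dualE.
  have [[_ a] _] := fP (n, t n) (t_ge0 n) IH.
  by apply: (le_trans (a e Ee)); case/andP: (BP n).
have xP n := fP (n, t n) (t_ge0 n) (a0 n).
exists x; split.
- by move=> n; have [[]] := xP n.
- by move=> e n Ee; have [[_ /(_ e Ee)]] := xP n; rewrite /= tE var_recr.
- move=> n z yz za e Ee; have [_] := xP n; apply => //; split => // e' Ee' /=.
  by rewrite tE; exact: za.
Qed.

(** A signed sum of [y] has size at most [J] at functionals with [s e <= J], but its largest value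
    over [E] can exceed [J * t / h]. Scaling that largest value to [t] brings the others below
    [h]. *)
Lemma small_vector (y : nat -> X) (s : (X -> R) -> R) (J t h : R) :
  (forall e n, E e -> var e y 0 n <= s e) ->
  (forall A, exists2 e, E e & exists n, A < var e y 0 n) ->
  0 < t -> 0 < h ->
  exists z, [/\ lin_span y z, exists2 e, E e & `|e z| = t,
    forall e, E e -> `|e z| <= t &
    forall e, E e -> s e <= J -> `|e z| <= h].
Proof.
move=> ys yoo t0 h0.
have [e1 Ee1 [n]] := yoo (Num.max 0 (J * t / h)).
rewrite gt_max => /andP[v0 vJ].
pose v := \sum_(0 <= i < n) Num.sg (e1 (y i)) *: y i.
have ev e : E e -> `|e v| <= var e y 0 n.
  move=> Ee; rewrite -[leRHS]mul1r; apply: ler_dual_sum; first exact: dualE.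
  by move=> i _; exact: normr_sg_le1.
have [e2 [Ee2 _ e2P]] := E_attain v.
have e2v : var e1 y 0 n <= `|e2 v|.
  apply: le_trans (e2P _ Ee1); rewrite var_sg; last exact: dualE.
  exact: ler_norm.
have L0 : 0 < `|e2 v| by exact: lt_le_trans e2v.
exists ((t / `|e2 v|) *: v).
have ezE e : E e -> `|e ((t / `|e2 v|) *: v)| = t / `|e2 v| * `|e v|.
  move=> Ee; rewrite dual_eltZ; last exact: dualE.
  by rewrite normrM gtr0_norm // divr_gt0.
split.
- rewrite -(addr0 (_ *: _)); apply: lin_spanD; last exact: lin_span0.
  by apply: lin_span_sum; exact: lin_span_id.
- by exists e2 => //; rewrite ezE // divfK // gt_eqF.
- move=> e Ee; rewrite ezE // mulrAC ler_pdivrMr // ler_pM2l //.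
  exact: e2P.
- move=> e Ee sJ; rewrite ezE // mulrAC ler_pdivrMr //.
  have : J * t < h * `|e2 v|.
    by rewrite [ltRHS]mulrC -ltr_pdivrMr // (lt_le_trans vJ).
  have := ler_wpM2l (ltW t0) (le_trans (ev e Ee) (le_trans (ys e n Ee) sJ)).
  by lra.
Qed.

(* [s e] bounds the total variation of [y] along [e]. The weight [w] strictly
   decreases with [s], so a maximizer [e0] of the variation of [x] has weighted
   variation [N > M], while beyond [s e > J] the weighted variation stays below
   [N - g]: a vector of norm [g / 4] that is tiny on [s e <= J] is a competitor
   at every late step of the greedy construction. *)
Lemma bounded_variation (y : nat -> X) (s : (X -> R) -> R) :
  (forall e n, E e -> var e y 0 n <= s e) ->
  ~ c0_embeds_in (closed_lin_span y) ->
  exists A, forall e n, E e -> var e y 0 n <= A.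
Proof.
move=> ys nc0; apply: contrapT => unb.
have yoo A : exists2 e, E e & exists n, A < var e y 0 n.
  apply: contrapT => noe; apply: unb; exists A => e n Ee.
  by rewrite leNgt; apply/negP => h; apply: noe; exists e => //; exists n.
have s0 e : E e -> 0 <= s e.
  by move=> Ee; apply: le_trans (ys e 0%N Ee); exact: var_ge0.
pose w e := 1 + (1 + s e)^-1.
(* The budget rises strictly from 1 and never exceeds 2: variations of [x] stay bounded, yet each
   step brings fresh room. *)
pose B n : R := 2 - n.+1%:R^-1.
have B_lt n : B n < B n.+1.
  by rewrite /B ltrD2l ltrN2 ltf_pV2 ?posrE ?ltr0n// ltr_nat.
have w1 e : E e -> 1 < w e.
  by move=> Ee; rewrite /w ltrDl invr_gt0; have := s0 e Ee; lra.
have w2 e : E e -> w e <= 2.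
  move=> Ee; have := s0 e Ee => h; rewrite /w.
  have : (1 + s e)^-1 <= 1 by rewrite invf_le1; lra.
  lra.
have B01 : B 0%N = 1 by rewrite /B invr1; lra.
have B_ge1 n : 1 <= B n.
  by elim: n => [|n]; [rewrite B01|have := B_lt n; lra].
have B2 n : B n <= 2 by rewrite /B gerBl invr_ge0 ler0n.
have [||x [yx xB xmax]] := @greedy_sequence y w B.
- by move=> e /w1/ltW.
- by move=> n; apply/andP; split; [have := B_ge1 n; lra|exact/ltW/B_lt].
have xA e n : E e -> var e x 0 n <= 2.
  move=> Ee; apply: (@le_trans _ _ (var e x 0 n.+1)); first exact: le_var.
  have := xB e n Ee; have := w1 e Ee; have := B2 n; have := var_ge0 e x 0 n.+1.
  nra.
have tail := uniform_tail yx xA nc0.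
have [e0 Ee0 [M [xM e0M]]] := sup_variation_attained xA tail.
(* A vector of size [1 / 2] fits the first budget [B 0 = 1] since [w <= 2], so greediness makes
   [x 0] nonzero on [E]. *)
have M_gt0 : 0 < M.
  have [z [yz [e Ee ez] zt _]] :=
    @small_vector y s 0 (1 / 2) 1 ys yoo ltac:(lra) ltac:(lra).
  have [|e' Ee'] := xmax 0%N z yz _ e Ee.
    move=> e' Ee'; rewrite /var big_geq // add0r B01.
    have := zt e' Ee'; have := w2 e' Ee'; have := w1 e' Ee'.
    have := normr_ge0 (e' z); nra.
  by rewrite ez; have := xM e' 1%N Ee'; rewrite var1; lra.
have [n0 gap] : exists n0, M < w e0 * var e0 x 0 n0.
  pose th := w e0 - 1; have th0 : 0 < th by have := w1 _ Ee0; rewrite /th; lra.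
  have th1 : th <= 1 by have := w2 _ Ee0; rewrite /th; lra.
  (* Uses [(1 + th) * (1 - th / 3) > 1] for [0 < th <= 1]. *)
  have [|n0 h] := e0M (M * th / 3); first by rewrite divr_gt0 ?mulr_gt0.
  exists n0; rewrite (_ : w e0 = 1 + th); last by rewrite /th; lra.
  have : 0 < M * th * (1 - th / 2) by rewrite !mulr_gt0 //; lra.
  nra.
set N := w e0 * _ in gap.
(* [J] solves [M / J = N - M], so [M / (1 + J) < N - M], which makes the gap [g] positive. *)
pose J := M / (N - M).
have J0 : 0 < J by rewrite divr_gt0 //; lra.
pose g := N - (1 + (1 + J)^-1) * M.
have g0 : 0 < g.
  have : (1 + J)^-1 * M < N - M.
    rewrite mulrC ltr_pdivrMr; last lra.
    have : (N - M) * J = M by rewrite /J mulrC divfK // gt_eqF; lra.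
    lra.
  rewrite /g; lra.
(* Greediness will give [g / 4 <= 2 * |e' (x n.+1)|], against the bound [g / 16] on this tail. *)
have [|k kg] := tail (g / 16); first by lra.
(* [h] is half the budget increment because [w <= 2]. *)
pose n := maxn k n0; pose h := (B n.+1 - B n) / 2.
have h0 : 0 < h by have := B_lt n; rewrite /h; lra.
have g40 : 0 < g / 4 by lra.
have [z [yz [e Ee ez] zt zh]] := @small_vector y s J (g / 4) h ys yoo g40 h0.
have [|e' Ee'] := xmax n.+1 z yz _ e Ee.
  move=> e' Ee'; have := normr_ge0 (e' z) => ez0.
  have we1 := w1 e' Ee'; have we2 := w2 e' Ee'.
  have [sJ|Js] := leP (s e') J.
    have := zh e' Ee' sJ; have := xB e' n Ee'; rewrite /h mulrDr => h1 h2.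
    have : w e' * `|e' z| <= 2 * ((B n.+1 - B n) / 2) by apply: ler_pM; lra.
    lra.
  (* Now [s e' > J]: the past uses at most [N - g] and [z] adds at most [g / 2], so the total stays
     below [N <= B n]. *)
  have : w e' <= 1 + (1 + J)^-1 by rewrite /w lerD2l lef_pV2 ?posrE; lra.
  have : N <= B n.
    apply: le_trans (xB e0 n Ee0); rewrite /N ler_wpM2l //.
      by have := w1 _ Ee0; lra.
    by apply: le_var => //; rewrite leqW // leq_maxr.
  have := B_lt n => Bn NB wJ.
  have : w e' * var e' x 0 n.+1 <= (1 + (1 + J)^-1) * M.
    by apply: ler_pM => //; [lra|exact: var_ge0|exact: xM].
  rewrite (_ : (1 + (1 + J)^-1) * M = N - g); last by rewrite /g subKr.
  have : w e' * `|e' z| <= 2 * (g / 4) by apply: ler_pM; [lra|..|exact: zt].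
  by move=> h1 h2; rewrite mulrDr; lra.
rewrite ez; have := kg e' n.+2 Ee'.
have : var e' x n.+1 n.+2 <= var e' x k n.+2.
  by apply: le_var => //; rewrite leqW // leq_maxl.
rewrite var1; lra.
Qed.

(** * Unconditional convergence *)

(** The bijection sends late indices beyond [k] without repetition, so a rearranged block is
    dominated by a tail variation in the original order. *)
Lemma uncond_convergent_of_tail (y : nat -> X) :
  (forall d, 0 < d -> exists k, forall e n, E e -> var e y k n <= d) ->
  uncond_convergent y.
Proof.
move=> tail s [s' sK s'K]; apply: cvg_series_tail => d d0.
have d0' : 0 < d / C / 2 by rewrite !divr_gt0.
have [k kd] := tail _ d0'.
(* [K] lies past the preimages of all indices below [k]. *)
pose K := \max_(i < k) (s' i).+1.
exists K => m n Km.
have ks i : (m <= i)%N -> (k <= s i)%N.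
  move=> mi; rewrite leqNgt; apply/negP => sik.
  have := @leq_bigmax _ (fun i : 'I_k => (s' i).+1) (Ordinal sik).
  by rewrite /= sK -/K => /(leq_trans)/(_ Km); rewrite ltnNge mi.
have [e [Ee le _]] := E_attain (\sum_(m <= i < n) y (s i)).
apply: (le_lt_trans le).
pose L := \max_(m <= i < n) (s i).+1.
apply: (@le_lt_trans _ _ (C * (d / C / 2))); last first.
  by rewrite -mulrA mulrCA mulVKf ?gt_eqF//; lra.
rewrite ler_pM2l //; apply: le_trans (kd e L Ee).
under eq_bigr do rewrite -[y _]scale1r.
apply: le_trans (ler_dual_sum (d := 1) (fun i => y (s i)) (dualE Ee) _) _.
  by move=> i _; rewrite normr1.
rewrite mul1r /var -(big_map s xpredT (fun i => `|e (y i)|)).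
set r := map _ _.
have rU : uniq r by rewrite map_inj_uniq ?iota_uniq //; exact: can_inj sK.
have rs : {subset r <= index_iota k L}.
  move=> j /mapP[i]; rewrite mem_index_iota => imn ->.
  rewrite mem_index_iota ks /=; last by case/andP: imn.
  by rewrite /L (big_rem i) /= ?mem_index_iota // leq_max leqnn.
rewrite (perm_big [seq i <- index_iota k L | i \in r]) /=.
  rewrite big_filter big_mkcond /=; apply: ler_sum => i _.
  by case: ifP.
apply: uniq_perm => //; first by rewrite filter_uniq ?iota_uniq.
by move=> i; rewrite mem_filter; case: (boolP (i \in r)) => //= /rs ->.
Qed.

End Norming.

Theorem theorem1p9 (R : realType) (X : completeNormedModType R)
  (y : nat -> X) (E : set (X -> R)) :
  iso_precisely_norming E ->
  ~ c0_embeds_in (closed_lin_span y) ->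
  (forall e, E e -> cvgn (series (fun n => `|e (y n)|))) ->
  uncond_convergent y.
Proof.
move=> [dualE [C [C1 [E_le [E_ge E_sup]]]]] nc0 Ey.
have C0 : 0 < C by lra.
have E_attain u : exists e, [/\ E e, `|u| <= C * `|e u| &
    forall e', E e' -> `|e' u| <= `|e u|].
  have [e Ee eu] := E_sup u; exists e; split => //.
    by have := E_ge u; rewrite -eu mulrC ler_pdivrMr // mulrC.
  move=> e' Ee'; rewrite eu; apply: ub_le_sup; last by exists e'.
  by exists (C * `|u|) => _ [e2 Ee2 <-]; exact: E_le.
have E_le' e u : E e -> `|e u| <= C * `|u| by move/E_le.
(* Each [e] has its own bound, its full sum; this step makes the bound uniform over [E]. *)
have [|A yA] := @bounded_variation _ _ E C dualE E_le' E_attain C0 y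
    (fun e => limn (series (fun n => `|e (y n)|))) _ nc0.
  move=> e n Ee; apply: (@nondecreasing_cvgn_le _ (series _)) (Ey e Ee) n.
  by apply: nondecreasing_series => i _ _.
apply: (uncond_convergent_of_tail dualE E_attain C0).
exact: (uniform_tail dualE E_le' E_attain C0 (@lin_span_id _ _ y) yA nc0).
Qed.
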